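(* Let $n\ge0$, $r,s\in\mathbb{Z}$, and $z\in\mathbb{C}$ with $z\ne0$, $|z|\ne1$. If $D_n^{(r)}\ne0$, then $$\hat P_n(z;r)=\frac{2z^{-2}}{D_n^{(r)}}\mathcal{D}_{n+1}\left[\frac{w(\zeta)\zeta^{-r}}{z^{-2}-\zeta^{-2}}\right]-w_r\delta_{n0},\qquad \hat Q_n(z;r)=-\frac{2z}{D_n^{(r)}}\mathcal{D}_{n+1}\left[\frac{w(\zeta)\zeta^{-r}}{z-\zeta}\right]+w_r\delta_{n0}.$$ If $E_n^{(s)}\ne0$, then $$\hat R_n(z;s)=\frac{2z^{-1}}{E_n^{(s)}}\mathcal{E}_{n+1}\left[\frac{w(\zeta)\zeta^{-s}}{z^{-1}-\zeta^{-1}}\right]-w_s\delta_{n0},\qquad \hat S_n(z;s)=-\frac{2z^2}{E_n^{(s)}}\mathcal{E}_{n+1}\left[\frac{w(\zeta)\zeta^{-s}}{z^2-\zeta^2}\right]+w_s\delta_{n0}.$$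
   Context: $\mathbb{T}$ is the unit circle, oriented counterclockwise; $w$ is a complex-valued integrable weight on $\mathbb{T}$ with Fourier coefficients $w_k=\int_{\mathbb{T}}\zeta^{-k}w(\zeta)\frac{d\zeta}{2\pi i\zeta}$. For $n\ge1$, $D_n^{(r)}=\det(w_{r+2j-k})_{0\le j,k\le n-1}$, $E_n^{(s)}=\det(w_{s+j-2k})_{0\le j,k\le n-1}$ ($j$ row index, $k$ column index), $D_0^{(r)}=E_0^{(s)}=1$; $\delta_{n0}$ is the Kronecker delta. For an integrable function $f$ on $\mathbb{T}$ and $n\geq1$, $$\mathcal{D}_n[f(\zeta)]=\frac1{n!}\int_{\mathbb{T}}\frac{d\zeta_1}{2\pi i\zeta_1}\cdots\int_{\mathbb{T}}\frac{d\zeta_n}{2\pi i\zeta_n}\prod_{j=1}^nf(\zeta_j)\prod_{1\le j<k\le n}(\zeta_k-\zeta_j)(\zeta_k^{-2}-\zeta_j^{-2}),$$ $$\mathcal{E}_n[f(\zeta)]=\frac1{n!}\int_{\mathbb{T}}\frac{d\zeta_1}{2\pi i\zeta_1}\cdots\int_{\mathbb{T}}\frac{d\zeta_n}{2\pi i\zeta_n}\prod_{j=1}^nf(\zeta_j)\prod_{1\le j<k\le n}(\zeta_k^2-\zeta_j^2)(\zeta_k^{-1}-\zeta_j^{-1}).$$ When $D_n^{(r)}\ne0$, $P_n(z;r)$ and $Q_n(z;r)$ are the unique monic polynomials of degree $n$ with $\int_{\mathbb{T}}P_n(\zeta;r)\zeta^{-2m-r}w(\zeta)\frac{d\zeta}{2\pi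 i\zeta}=0$ and $\int_{\mathbb{T}}Q_n(\zeta^{-2};r)\zeta^{m-r}w(\zeta)\frac{d\zeta}{2\pi i\zeta}=0$ for $0\le m\le n-1$. When $E_n^{(s)}\ne0$, $R_n(z;s)$ and $S_n(z;s)$ are the unique monic polynomials of degree $n$ with $\int_{\mathbb{T}}R_n(\zeta^2;s)\zeta^{-m-s}w(\zeta)\frac{d\zeta}{2\pi i\zeta}=0$ and $\int_{\mathbb{T}}S_n(\zeta^{-1};s)\zeta^{2m-s}w(\zeta)\frac{d\zeta}{2\pi i\zeta}=0$ for $0\le m\le n-1$. Associated functions: $\hat P_n(z;r)=\int_{\mathbb{T}}\frac{d\zeta}{2\pi i\zeta}w(\zeta)\zeta^{-r}\frac{\zeta^2+z^2}{\zeta^2-z^2}P_n(\zeta;r)$, $\hat Q_n(z;r)=\int_{\mathbb{T}}\frac{d\zeta}{2\pi i\zeta}w(\zeta)\zeta^{-r}\frac{\zeta+z}{\zeta-z}Q_n(\zeta^{-2};r)$, $\hat R_n(z;s)=\int_{\mathbb{T}}\frac{d\zeta}{2\pi i\zeta}w(\zeta)\zeta^{-s}\frac{\zeta+z}{\zeta-z}R_n(\zeta^{2};s)$, $\hat S_n(z;s)=\int_{\mathbb{T}}\frac{d\zeta}{2\pi i\zeta}w(\zeta)\zeta^{-s}\frac{\zeta^2+z^2}{\zeta^2-z^2}S_n(\zeta^{-1};s)$. *)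

(* Defs.v *)
From HB Require Import structures.
From mathcomp Require Import all_boot all_order all_algebra.
From mathcomp Require Import complex.
From mathcomp Require Import all_classical all_reals all_analysis.

Set Implicit Arguments.
Unset Strict Implicit.
Unset Printing Implicit Defensive.

Import Order.TTheory GRing.Theory Num.Theory.
Local Open Scope classical_set_scope.
Local Open Scope complex_scope.
Local Open Scope ring_scope.

Section CircleIntegral.
Context {R : realType}.
Local Notation C := R[i].

Definition circle_point (t : R) : C := cos t +i* sin t.

(* Lebesgue integrability on the unit circle; only the values of f on the
   circle matter. *)
Definition circle_integrable (f : C -> C) : Prop :=
  (@lebesgue_measure R).-integrable `[0, 2 * pi]
    (fun t => (complex.Re (f (circle_point t)))%:E) /\
  (@lebesgue_measure R).-integrable `[0, 2 * pi]
    (fun t => (complex.Im (f (circle_point t)))%:E).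

(* The integral of f against d zeta / (2 pi i zeta) over the counterclockwise
   unit circle: with zeta = e^(it), this measure is dt / (2 pi). *)
Definition circle_int (f : C -> C) : C :=
  ((2 * pi)^-1 *
     \int[@lebesgue_measure R]_(t in `[0, 2 * pi])
       complex.Re (f (circle_point t)))%R
  +i*
  ((2 * pi)^-1 *
     \int[@lebesgue_measure R]_(t in `[0, 2 * pi])
       complex.Im (f (circle_point t)))%R.

(* n-fold iterated integral; component 0 of the tuple is the variable of the
   outermost integral. *)
Fixpoint circle_iterint (n : nat) : (n.-tuple C -> C) -> C :=
  match n with
  | 0 => fun F => F [tuple]
  | m.+1 => fun F =>
      circle_int (fun zeta => circle_iterint (fun v : m.-tuple C =>
        F [tuple of zeta :: v]))
  end.

Definition calD (n : nat) (f : C -> C) : C :=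
  (n`!)%:R^-1 * circle_iterint (fun v : n.-tuple C =>
    (\prod_(j < n) f (tnth v j)) *
    \prod_(j < n) \prod_(k < n | (j < k)%N)
      ((tnth v k - tnth v j) * (tnth v k ^- 2 - tnth v j ^- 2))).

Definition calE (n : nat) (f : C -> C) : C :=
  (n`!)%:R^-1 * circle_iterint (fun v : n.-tuple C =>
    (\prod_(j < n) f (tnth v j)) *
    \prod_(j < n) \prod_(k < n | (j < k)%N)
      ((tnth v k ^+ 2 - tnth v j ^+ 2) * ((tnth v k)^-1 - (tnth v j)^-1))).

End CircleIntegral.

Section Biorthogonal.
Context {R : realType}.
Local Notation C := R[i].
Variable w : C -> C.

Definition fourier_coef (k : int) : C :=
  circle_int (fun zeta => zeta ^ (- k) * w zeta).

Definition detD (n : nat) (r : int) : C :=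
  \det (\matrix_(j < n, k < n)
    fourier_coef (r + 2 * (j : nat)%:Z - (k : nat)%:Z)).

Definition detE (n : nat) (s : int) : C :=
  \det (\matrix_(j < n, k < n)
    fourier_coef (s + (j : nat)%:Z - 2 * (k : nat)%:Z)).

Definition monic_deg (n : nat) (p : {poly C}) : Prop :=
  p \is monic /\ size p = n.+1.

(* Each polynomial below is the unique one with the stated property when
   detD n r (for biorthP and biorthQ), resp. detE n s (for biorthR and biorthS), is
   nonzero; it is a junk value (0) if no such polynomial exists. *)

Definition biorthP (n : nat) (r : int) : {poly C} :=
  xget 0 [set p | monic_deg n p /\ forall m : nat, (m < n)%N ->
    circle_int (fun zeta => p.[zeta] * zeta ^ (- (2 * m%:Z) - r) * w zeta) = 0].

Definition biorthQ (n : nat) (r : int) : {poly C} :=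
  xget 0 [set p | monic_deg n p /\ forall m : nat, (m < n)%N ->
    circle_int (fun zeta => p.[zeta ^- 2] * zeta ^ (m%:Z - r) * w zeta) = 0].

Definition biorthR (n : nat) (s : int) : {poly C} :=
  xget 0 [set p | monic_deg n p /\ forall m : nat, (m < n)%N ->
    circle_int (fun zeta => p.[zeta ^+ 2] * zeta ^ (- m%:Z - s) * w zeta) = 0].

Definition biorthS (n : nat) (s : int) : {poly C} :=
  xget 0 [set p | monic_deg n p /\ forall m : nat, (m < n)%N ->
    circle_int (fun zeta => p.[zeta^-1] * zeta ^ (2 * m%:Z - s) * w zeta) = 0].

Definition hatP (n : nat) (r : int) (z : C) : C :=
  circle_int (fun zeta => w zeta * zeta ^ (- r) *
    ((zeta ^+ 2 + z ^+ 2) / (zeta ^+ 2 - z ^+ 2)) * (biorthP n r).[zeta]).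

Definition hatQ (n : nat) (r : int) (z : C) : C :=
  circle_int (fun zeta => w zeta * zeta ^ (- r) *
    ((zeta + z) / (zeta - z)) * (biorthQ n r).[zeta ^- 2]).

Definition hatR (n : nat) (s : int) (z : C) : C :=
  circle_int (fun zeta => w zeta * zeta ^ (- s) *
    ((zeta + z) / (zeta - z)) * (biorthR n s).[zeta ^+ 2]).

Definition hatS (n : nat) (s : int) (z : C) : C :=
  circle_int (fun zeta => w zeta * zeta ^ (- s) *
    ((zeta ^+ 2 + z ^+ 2) / (zeta ^+ 2 - z ^+ 2)) * (biorthS n s).[zeta^-1]).

End Biorthogonal.

(* Main.v *)
(* With a = zeta^-2 and b = zeta for P (and similarly for Q, R, S), Andreief's
   identity turns the (n+1)-fold integral with weight W / (x - a), where x is a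
   evaluated at z, into the determinant of the moments of a^i b^k against this
   weight.  Replacing the rows a^i by 1, (x - a), (x - a) a, ..., (x - a) a^(n-1)
   and the last column b^n by p(b), where p is the biorthogonal polynomial,
   cancels the denominator in every row but the first and, by orthogonality,
   leaves a single nonzero entry in the last column.  The integral is thus D_n
   (or E_n) times the integral of W p(b) / (x - a).  The kernel of the associated
   function is c / (x - a) minus a constant e = 1 or -1; that constant integrates
   against W p(b) to zero unless n = 0, which is the Kronecker delta term. *)
Require Import Defs.
From mathcomp Require Import all_boot all_order all_algebra all_fingroup.
From mathcomp Require Import complex.
From mathcomp Require Import all_classical all_reals all_analysis.
From mathcomp Require Import measurable_realfun ring.

Import Order.TTheory GRing.Theory Num.Theory.
Import numFieldNormedType.Exports.
Local Open Scope complex_scope.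
Local Open Scope ring_scope.

(** * Continuity of functions along the circle *)

Section CircleIntegration.
Context {R : realType}.
Local Notation C := R[i].
Implicit Types (f g h : C -> C) (c : C).

Lemma complexReD (x y : C) : complex.Re (x + y) = complex.Re x + complex.Re y.
Proof. by case: x; case: y. Qed.

Lemma complexImD (x y : C) : complex.Im (x + y) = complex.Im x + complex.Im y.
Proof. by case: x; case: y. Qed.

Lemma complexReM (x y : C) : complex.Re (x * y) =
  complex.Re x * complex.Re y - complex.Im x * complex.Im y.
Proof. by case: x; case: y. Qed.

Lemma complexImM (x y : C) : complex.Im (x * y) =
  complex.Re x * complex.Im y + complex.Im x * complex.Re y.
Proof. by case: x; case: y. Qed.

Lemma complex_ext (x y : C) :
  complex.Re x = complex.Re y -> complex.Im x = complex.Im y -> x = y.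
Proof. by case: x y => [a b] [a' b'] /= -> ->. Qed.

(** Only values on the circle count, so negative powers, singular at 0, qualify. The split into real
    and imaginary parts matches [circle_integrable]. *)
Definition circle_continuous g : Prop :=
  continuous (fun t : R => complex.Re (g (circle_point t))) /\
  continuous (fun t : R => complex.Im (g (circle_point t))).

Lemma circle_continuous_cst c : circle_continuous (fun=> c).
Proof. by split=> t; exact: cvg_cst. Qed.

Lemma circle_continuous_id : circle_continuous id.
Proof. by split=> t /=; [exact: continuous_cos | exact: continuous_sin]. Qed.

Lemma circle_continuousD f g : circle_continuous f -> circle_continuous g ->
  circle_continuous (fun zeta => f zeta + g zeta).
Proof.
move=> [f1 f2] [g1 g2]; split=> t.
  rewrite (_ : (fun _ => _) = (fun u => complex.Re (f (circle_point u)))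
     \+ (fun u => complex.Re (g (circle_point u)))); last first.
    by apply/funext => u /=; rewrite complexReD.
  by apply: cvgD; [exact: f1 | exact: g1].
rewrite (_ : (fun _ => _) = (fun u => complex.Im (f (circle_point u)))
   \+ (fun u => complex.Im (g (circle_point u)))); last first.
  by apply/funext => u /=; rewrite complexImD.
by apply: cvgD; [exact: f2 | exact: g2].
Qed.

Lemma circle_continuousM f g : circle_continuous f -> circle_continuous g ->
  circle_continuous (fun zeta => f zeta * g zeta).
Proof.
move=> [f1 f2] [g1 g2]; split=> t.
  under eq_fun do rewrite complexReM.
  by apply: cvgB; apply: cvgM; [exact: f1|exact: g1|exact: f2|exact: g2].
under eq_fun do rewrite complexImM.
by apply: cvgD; apply: cvgM; [exact: f1|exact: g2|exact: f2|exact: g1].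
Qed.

Lemma circle_continuousV f : circle_continuous f ->
  (forall t, f (circle_point t) != 0) ->
  circle_continuous (fun zeta => (f zeta)^-1).
Proof.
move=> [f1 f2] fN0.
(* The squared modulus of [f]: the inverse of a + ib is a - ib divided by it. *)
pose N t := complex.Re (f (circle_point t)) ^+ 2
  + complex.Im (f (circle_point t)) ^+ 2.
have N0 t : N t != 0.
  apply: contra (fN0 t); rewrite /N.
  case: (f _) => a b /=; rewrite paddr_eq0 ?sqr_ge0// !sqrf_eq0.
  by move=> /andP[/eqP-> /eqP->].
have NV : continuous (fun t => (N t)^-1).
  move=> t; apply: cvgV => //.
  by apply: cvgD; apply: cvgM; (exact: f1 || exact: f2).
split=> t.
  rewrite (_ : (fun _ => _) = (fun u => complex.Re (f (circle_point u))
     * (N u)^-1)); last first.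
    by apply/funext => u /=; rewrite /N; case: (f _).
  by apply: cvgM; [exact: f1 | exact: NV].
rewrite (_ : (fun _ => _) = (fun u => - complex.Im (f (circle_point u))
   * (N u)^-1)); last first.
  by apply/funext => u /=; rewrite /N; case: (f _) => a b /=; rewrite mulNr.
by apply: cvgM; [apply: cvgN; exact: f2 | exact: NV].
Qed.

Lemma circle_continuousX f k : circle_continuous f ->
  circle_continuous (fun zeta => f zeta ^+ k).
Proof.
move=> fc; elim: k => [|k IH]; first exact: circle_continuous_cst.
under eq_fun do rewrite exprS.
exact: circle_continuousM.
Qed.

Lemma circle_continuous_sum (I : Type) (s : seq I) (F : I -> C -> C) :
  (forall i, circle_continuous (F i)) ->
  circle_continuous (fun zeta => \sum_(i <- s) F i zeta).
Proof.
move=> Fc; elim: s => [|i s IH].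
  by under eq_fun do rewrite big_nil; exact: circle_continuous_cst.
under eq_fun do rewrite big_cons.
exact: circle_continuousD.
Qed.

Lemma circle_continuous_horner (p : {poly C}) f : circle_continuous f ->
  circle_continuous (fun zeta => p.[f zeta]).
Proof.
move=> fc; under eq_fun do rewrite horner_coef.
apply: circle_continuous_sum => i; apply: circle_continuousM.
  exact: circle_continuous_cst.
exact: circle_continuousX.
Qed.

(** * Integrability on the circle and linearity of the integral *)

Definition real_circle_integrable (u : R -> R) : Prop :=
  (@lebesgue_measure R).-integrable `[0, 2 * pi]%classic (EFin \o u).

Lemma circle_integrableE f : circle_integrable f =
  (real_circle_integrable (fun t => complex.Re (f (circle_point t))) /\
   real_circle_integrable (fun t => complex.Im (f (circle_point t)))).
Proof. by []. Qed.

Lemma real_circle_integrableD (u v : R -> R) : real_circle_integrable u ->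
  real_circle_integrable v -> real_circle_integrable (fun t => u t + v t).
Proof. by move=> ui vi; apply: integrableD ui vi; exact: measurable_itv. Qed.

Lemma real_circle_integrableB (u v : R -> R) : real_circle_integrable u ->
  real_circle_integrable v -> real_circle_integrable (fun t => u t - v t).
Proof. by move=> ui vi; apply: integrableB ui vi; exact: measurable_itv. Qed.

(** The continuous factor is bounded on the compact interval, and a bounded measurable factor
    preserves integrability. *)
Lemma real_circle_integrableM (u v : R -> R) : real_circle_integrable u ->
  continuous v -> real_circle_integrable (fun t => u t * v t).
Proof.
move=> ui vc; apply: (integrableMl _ ui); first exact: measurable_itv.
  by apply: measurable_funTS; exact: continuous_measurable_fun.
have /compact_bounded : compact (v @` `[0, 2 * pi])%classic.
  apply: continuous_compact; last exact: segment_compact.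
  exact: continuous_subspaceT.
move=> [M [Mr MP]]; exists M; split => // N MN t tI /=.
by apply: (MP N MN); exists t.
Qed.

Lemma circle_integrableM f g : circle_integrable f -> circle_continuous g ->
  circle_integrable (fun zeta => f zeta * g zeta).
Proof.
rewrite !circle_integrableE => -[f1 f2] [g1 g2]; split.
  under eq_fun do rewrite complexReM.
  by apply: real_circle_integrableB; exact: real_circle_integrableM.
under eq_fun do rewrite complexImM.
by apply: real_circle_integrableD; exact: real_circle_integrableM.
Qed.

Lemma circle_integrableD f g : circle_integrable f -> circle_integrable g ->
  circle_integrable (fun zeta => f zeta + g zeta).
Proof.
rewrite !circle_integrableE => -[f1 f2] [g1 g2]; split.
  under eq_fun do rewrite complexReD.
  exact: real_circle_integrableD.
under eq_fun do rewrite complexImD.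
exact: real_circle_integrableD.
Qed.

Lemma circle_integrable_resolvent f g c : circle_integrable f ->
  circle_continuous g -> (forall t, g (circle_point t) != c) ->
  circle_integrable (fun zeta => f zeta / (c - g zeta)).
Proof.
move=> fi gc gN; apply: circle_integrableM => //.
apply: circle_continuousV => [|t]; last by rewrite subr_eq0 eq_sym.
apply: circle_continuousD; first exact: circle_continuous_cst.
under eq_fun do rewrite -mulN1r.
by apply: circle_continuousM => //; exact: circle_continuous_cst.
Qed.

Lemma circle_integrable0 : circle_integrable (fun=> 0 : C).
Proof. by split; exact: integrable0. Qed.

Lemma circle_int0 : circle_int (fun=> 0 : C) = 0.
Proof.
have E : Rintegral (@lebesgue_measure R) `[0, 2 * pi]%classic (fun=> 0) = 0.
  by rewrite /Rintegral integral0.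
by rewrite /circle_int /= E mulr0.
Qed.

Lemma circle_intD f g : circle_integrable f -> circle_integrable g ->
  circle_int (fun zeta => f zeta + g zeta) = circle_int f + circle_int g.
Proof.
move=> [f1 f2] [g1 g2]; apply: complex_ext.
  rewrite complexReD /=; under eq_Rintegral do rewrite complexReD.
  by rewrite RintegralD// mulrDr.
rewrite complexImD /=; under eq_Rintegral do rewrite complexImD.
by rewrite RintegralD// mulrDr.
Qed.

Lemma circle_intZ c f : circle_integrable f ->
  circle_int (fun zeta => c * f zeta) = c * circle_int f.
Proof.
move=> [f1 f2].
have Zi (u : R -> R) k :
    (@lebesgue_measure R).-integrable `[0, 2 * pi]%classic (EFin \o u) ->
    (@lebesgue_measure R).-integrable `[0, 2 * pi]%classic
      (EFin \o (fun t => k * u t)).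
  by move=> ui; apply: (integrableZl _ k ui).
apply: complex_ext.
  rewrite complexReM /=; under eq_Rintegral do rewrite complexReM.
  by rewrite RintegralB ?RintegralZl//; [ring|exact: Zi|exact: Zi].
rewrite complexImM /=; under eq_Rintegral do rewrite complexImM.
by rewrite RintegralD ?RintegralZl//; [ring|exact: Zi|exact: Zi].
Qed.

Lemma circle_integrableZ c f : circle_integrable f ->
  circle_integrable (fun zeta => c * f zeta).
Proof.
move=> fi; under eq_fun do rewrite mulrC.
by apply: circle_integrableM => //; exact: circle_continuous_cst.
Qed.

Lemma circle_int_sum (I : Type) (s : seq I) (F : I -> C -> C) (c : I -> C) :
  (forall i, circle_integrable (F i)) ->
  circle_int (fun zeta => \sum_(i <- s) c i * F i zeta) =
  \sum_(i <- s) c i * circle_int (F i).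
Proof.
move=> Fi.
(* The induction also carries integrability of the partial sums, which additivity of the integral
   requires. *)
suff [] : circle_integrable (fun zeta => \sum_(i <- s) c i * F i zeta) /\
  circle_int (fun zeta => \sum_(i <- s) c i * F i zeta) =
  \sum_(i <- s) c i * circle_int (F i) by [].
elim: s => [|i s [IHi IHe]].
  under eq_fun do rewrite big_nil.
  by rewrite big_nil circle_int0; split=> //; exact: circle_integrable0.
under eq_fun do rewrite big_cons.
rewrite big_cons; split.
  by apply: circle_integrableD => //; exact: circle_integrableZ.
by rewrite circle_intD ?circle_intZ ?IHe//; exact: circle_integrableZ.
Qed.

(** Serves to cancel denominators and to combine integer powers under the integral, which is
    justified only at points of the circle. *)
Lemma eq_circle_int f g : (forall t, f (circle_point t) = g (circle_point t)) ->
  circle_int f = circle_int g.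
Proof.
move=> fg; rewrite /circle_int.
by congr (_ +i* _); congr (_ * _); apply: eq_Rintegral => t _; rewrite fg.
Qed.

(** Linearity alone suffices: by induction the inner variables integrate to constants, which leaves
    a finite sum in the outermost variable. No order of integration is exchanged. *)
Lemma circle_iterint_sum_prod (I : Type) (s : seq I) (n : nat)
    (c : I -> C) (h : I -> 'I_n -> C -> C) :
  (forall i j, circle_integrable (h i j)) ->
  circle_iterint (fun v : n.-tuple C =>
     \sum_(i <- s) c i * \prod_(j < n) h i j (tnth v j)) =
  \sum_(i <- s) c i * \prod_(j < n) circle_int (h i j).
Proof.
elim: n c h => [|n IH] c h hi /=.
  by apply: eq_bigr => i _; rewrite !big_ord0.
transitivity (circle_int (fun zeta => \sum_(i <- s)
    (c i * \prod_(j < n) circle_int (h i (lift ord0 j))) * h i ord0 zeta)).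
  congr circle_int; apply/funext => zeta.
  transitivity (\sum_(i <- s) (c i * h i ord0 zeta) *
     \prod_(j < n) circle_int (h i (lift ord0 j))); last first.
    by apply: eq_bigr => i _; rewrite mulrAC.
  rewrite -(IH _ (fun i j => h i (lift ord0 j)))//.
  congr circle_iterint; apply/funext => v; apply: eq_bigr => i _.
  rewrite big_ord_recl mulrA; congr (_ * _ * _).
  by apply: eq_bigr => j _; rewrite tnthS.
rewrite circle_int_sum//; apply: eq_bigr => i _.
by rewrite big_ord_recl -mulrA; congr (_ * _); rewrite mulrC.
Qed.

End CircleIntegration.

(** * Andreief's identity and determinants of moments *)

Lemma sum_perm2_det (K : comNzRingType) (N : nat) (M : 'M[K]_N) :
  \sum_(st : 'S_N * 'S_N) (-1) ^+ st.1 * (-1) ^+ st.2 *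
    \prod_(j < N) M (st.1 j) (st.2 j) = N`!%:R * \det M.
Proof.
rewrite -(pair_bigA _ (fun s t : 'S_N =>
  (-1) ^+ s * (-1) ^+ t * \prod_(j < N) M (s j) (t j)))/=.
rewrite (eq_bigr (fun=> \det M)) => [|s _].
  by rewrite sumr_const card_Sn mulr_natl.
(* Replacing t by s * t cancels the sign of s, and reindexing the product by s then gives the
   Leibniz formula; each of the N! choices of s contributes one copy of the determinant. *)
rewrite (reindex_inj (mulgI s))/=; apply: eq_bigr => t _.
rewrite odd_permM signr_addb mulrA -expr2 sqrr_sign mul1r; congr (_ * _).
rewrite [RHS](reindex_inj (@perm_inj _ s))/=.
by apply: eq_bigr => j _; rewrite permM.
Qed.

Section Andreief.
Context {R : realType}.
Local Notation C := R[i].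

(** Both Vandermonde products expand over permutations, so the integrand is a double sum of products
    of one-variable functions. Integrated term by term, it becomes the sum evaluated in
    [sum_perm2_det]. *)
Lemma andreief (N : nat) (f a b : C -> C) : circle_integrable f ->
  circle_continuous a -> circle_continuous b ->
  circle_iterint (fun v : N.-tuple C =>
    (\prod_(j < N) f (tnth v j)) *
    \prod_(j < N) \prod_(k < N | (j < k)%N)
      ((b (tnth v k) - b (tnth v j)) * (a (tnth v k) - a (tnth v j)))) =
  N`!%:R * \det (\matrix_(i < N, k < N)
    circle_int (fun zeta => f zeta * (a zeta ^+ i * b zeta ^+ k))).
Proof.
move=> fi ac bc.
pose h (st : 'S_N * 'S_N) (j : 'I_N) zeta :=
  f zeta * (a zeta ^+ st.1 j * b zeta ^+ st.2 j).
transitivity (\sum_(st : 'S_N * 'S_N) (-1) ^+ st.1 * (-1) ^+ st.2 *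
    \prod_(j < N) circle_int (h st j)); last first.
  rewrite -sum_perm2_det; apply: eq_bigr => st _; congr (_ * _).
  by apply: eq_bigr => j _; rewrite mxE.
rewrite -circle_iterint_sum_prod => [|st j]; last first.
  by apply: circle_integrableM => //; apply: circle_continuousM;
    exact: circle_continuousX.
congr circle_iterint; apply/funext => v.
have vdm (u : C -> C) :
    \prod_(j < N) \prod_(k < N | (j < k)%N) (u (tnth v k) - u (tnth v j)) =
    \sum_(s : 'S_N) (-1) ^+ s * \prod_(j < N) u (tnth v j) ^+ s j.
  transitivity (\det (Vandermonde N (\row_(j < N) u (tnth v j)))).
    rewrite det_Vandermonde; apply: eq_bigr => j _; apply: eq_bigr => k _.
    by rewrite !mxE.
  rewrite -det_tr; apply: eq_bigr => s _; congr (_ * _).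
  by apply: eq_bigr => j _; rewrite !mxE.
under [X in _ * X = _]eq_bigr do rewrite big_split.
rewrite big_split/= !vdm [X in _ * X]mulrC big_distrlr/= pair_bigA/= mulr_sumr.
apply: eq_bigr => st _; rewrite /h !big_split mulrACA.
exact: mulrCA.
Qed.

Lemma circle_int_horner2 (N : nat) (f a b : C -> C) (t u : {poly C}) :
  circle_integrable f -> circle_continuous a -> circle_continuous b ->
  (size t <= N)%N -> (size u <= N)%N ->
  circle_int (fun zeta => f zeta * (t.[a zeta] * u.[b zeta])) =
  \sum_(i < N) \sum_(k < N) t`_i * u`_k *
    circle_int (fun zeta => f zeta * (a zeta ^+ i * b zeta ^+ k)).
Proof.
move=> fi ac bc tN uN.
rewrite pair_bigA/= -circle_int_sum => [|ik]; last first.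
  by apply: circle_integrableM => //; apply: circle_continuousM;
    exact: circle_continuousX.
congr circle_int; apply/funext => zeta.
rewrite (horner_coef_wide _ tN) (horner_coef_wide _ uN) big_distrlr/=.
rewrite pair_bigA/= mulr_sumr; apply: eq_bigr => ik _; ring.
Qed.

(** Passing from monomials to [t] and [u] multiplies the moment matrix on both sides by coefficient
    matrices. The size bounds make these triangular, so only diagonal coefficients enter their
    determinants. *)
Lemma det_circle_int_horner2 (N : nat) (f a b : C -> C)
    (t u : 'I_N -> {poly C}) :
  circle_integrable f -> circle_continuous a -> circle_continuous b ->
  (forall i, size (t i) <= i.+1)%N -> (forall k, size (u k) <= k.+1)%N ->
  \det (\matrix_(i < N, k < N)
    circle_int (fun zeta => f zeta * ((t i).[a zeta] * (u k).[b zeta]))) =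
  (\prod_(i < N) (t i)`_i) * (\prod_(k < N) (u k)`_k) *
  \det (\matrix_(i < N, k < N)
    circle_int (fun zeta => f zeta * (a zeta ^+ i * b zeta ^+ k))).
Proof.
move=> fi ac bc ts us.
pose T (q : 'I_N -> {poly C}) : 'M[C]_N := \matrix_(i < N, j < N) (q i)`_j.
have detT (q : 'I_N -> {poly C}) : (forall i, size (q i) <= i.+1)%N ->
    \det (T q) = \prod_(i < N) (q i)`_i.
  move=> qs; rewrite det_trig; first by apply: eq_bigr => i _; rewrite mxE.
  apply/is_trig_mxP => i j ij; rewrite mxE nth_default//.
  exact: leq_trans (qs i) ij.
rewrite -!detT// -(det_tr (T u)) mulrAC -!det_mulmx; congr (\det _).
apply/matrixP => i k; rewrite !mxE.
rewrite (@circle_int_horner2 N)//; last 2 first.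
- exact: leq_trans (ts i) (ltn_ord i).
- exact: leq_trans (us k) (ltn_ord k).
rewrite exchange_big/=; apply: eq_bigr => l _.
rewrite !mxE mulr_suml; apply: eq_bigr => j _; rewrite !mxE; ring.
Qed.

(** * The kernel determinant and the biorthogonal polynomials *)

Lemma det_circle_int_kernel (n : nat) (W a b : C -> C) (x : C) (p : {poly C}) :
  circle_integrable W -> circle_continuous a -> circle_continuous b ->
  (forall t, a (circle_point t) != x) -> monic_deg n p ->
  (forall m, (m < n)%N ->
    circle_int (fun zeta => W zeta * (a zeta ^+ m * p.[b zeta])) = 0) ->
  \det (\matrix_(i < n.+1, k < n.+1)
    circle_int (fun zeta => W zeta / (x - a zeta) *
                            (a zeta ^+ i * b zeta ^+ k))) =
  circle_int (fun zeta => W zeta / (x - a zeta) * p.[b zeta]) *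
  \det (\matrix_(i < n, k < n)
    circle_int (fun zeta => W zeta * (a zeta ^+ i * b zeta ^+ k))).
Proof.
move=> Wi ac bc xa [pm ps] orth.
have xa0 t : x - a (circle_point t) != 0 by rewrite subr_eq0 eq_sym.
set f := fun zeta => W zeta / (x - a zeta).
have fi : circle_integrable f := circle_integrable_resolvent W a x Wi ac xa.
have fMX m y tt (q := (x%:P - 'X) * 'X^m : {poly C}) :
    f (circle_point tt) * (q.[a (circle_point tt)] * y) =
    W (circle_point tt) * (a (circle_point tt) ^+ m * y).
  rewrite /q /f hornerM hornerXn hornerD hornerN hornerC hornerX.
  by field; exact: xa0.
pose t (i : 'I_n.+1) : {poly C} :=
  if unlift ord0 i is Some m then (x%:P - 'X) * 'X^m else 1.
pose u (k : 'I_n.+1) : {poly C} := if (k < n)%N then 'X^k else p.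
have := @det_circle_int_horner2 n.+1 f a b t u fi ac bc.
have -> : \prod_(i < n.+1) (t i)`_i = (-1) ^+ n.
  rewrite big_ord_recl /t unlift_none coef1 mul1r (eq_bigr (fun=> -1)).
    by rewrite prodr_const card_ord.
  move=> i _; rewrite liftK /= coefMXn ltnNge leqnSn /= /bump /= subSn//.
  by rewrite subnn coefB coefC coefX sub0r.
have -> : \prod_(k < n.+1) (u k)`_k = 1.
  rewrite big1// => k _; rewrite /u; case: ifPn => [_|]; first by rewrite coefXn eqxx.
  rewrite -leqNgt => nk; have -> : k = n :> nat.
    by apply/eqP; rewrite eqn_leq nk -ltnS ltn_ord.
  by move/monicP: pm; rewrite lead_coefE ps.
(* Both sides are multiplied by (-1)^n: on the left this is the product of the diagonal coefficients
   of [t], on the right the cofactor sign of the entry in row 0 and column n. *)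
rewrite mulr1 => /(_ _ _)/= H; apply: (can_inj (signrMK n)).
rewrite -H; last 2 first.
- move=> i; rewrite /t; case: unliftP => [j ->|->]; last by rewrite size_poly1.
  apply: leq_trans (size_polyMleq _ _) _.
  rewrite size_polyXn addnS -[X in (_ <= X)%N]/(2 + j)%N leq_add2r.
  by rewrite -opprB size_polyN size_XsubC.
- move=> k; rewrite /u; case: ifPn => [_|]; first by rewrite size_polyXn.
  by rewrite -leqNgt ps ltnS.
(* In the last column, row m + 1 holds the orthogonality integral of index m, so only row 0
   survives. *)
rewrite (expand_det_col _ ord_max) big_ord_recl big1 ?addr0 => [|i _]; last first.
  rewrite mxE /t liftK /u ltnn.
  rewrite (_ : circle_int _ = 0) ?mul0r// -(orth i (ltn_ord i)).
  by apply: eq_circle_int => tt; rewrite fMX.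
rewrite /cofactor add0n mulrCA; congr (_ * _).
congr (_ * _).
  rewrite mxE /t unlift_none /u ltnn.
  by congr circle_int; apply/funext => zeta; rewrite hornerC mul1r.
apply: (congr1 determinant); apply/matrixP => i k; rewrite !mxE.
rewrite /t liftK /u /= /bump [(n <= k)%N]leqNgt ltn_ord /= ltn_ord.
by apply: eq_circle_int => tt; rewrite fMX hornerXn.
Qed.

(** For X^n plus lower terms, orthogonality is a square linear system in the lower coefficients, and
    its matrix is the invertible moment matrix. *)
Lemma exists_monic_orthogonal (n : nat) (W a b : C -> C) :
  circle_integrable W -> circle_continuous a -> circle_continuous b ->
  \det (\matrix_(i < n, k < n)
    circle_int (fun zeta => W zeta * (a zeta ^+ i * b zeta ^+ k))) != 0 ->
  exists p : {poly C}, monic_deg n p /\ forall m, (m < n)%N ->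
    circle_int (fun zeta => W zeta * (a zeta ^+ m * p.[b zeta])) = 0.
Proof.
move=> Wi ac bc; set M := (\matrix_(i, k) _) => detM.
have Mu : M \in unitmx by rewrite unitmxE unitfE.
(* [v] is the contribution of the leading term b^n; the coefficient vector [c] solves M c + v =
   0. *)
pose v : 'cV_n := \col_(i < n)
  circle_int (fun zeta => W zeta * (a zeta ^+ i * b zeta ^+ n)).
pose c := - (invmx M *m v).
pose q : {poly C} := \sum_(k < n) c k 0 *: 'X^k.
have qs : (size q <= n)%N.
  apply: leq_trans (size_sum _ _ _) _; apply/bigmax_leqP => k _.
  by apply: leq_trans (size_scale_leq _ _) _; rewrite size_polyXn.
exists ('X^n + q); split.
  have qX : (size q < size ('X^n : {poly C}))%N by rewrite size_polyXn ltnS.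
  split; last by rewrite size_polyDl// size_polyXn.
  by rewrite monicE lead_coefDl// lead_coefXn.
move=> m mn; pose i := Ordinal mn.
have : (M *m c) i 0 + v i 0 = 0 by rewrite /c mulmxN mulKVmx// mxE addNr.
rewrite !mxE => <-.
have Wab k l : circle_integrable (fun zeta => W zeta * (a zeta ^+ k * b zeta ^+ l)).
  by apply: circle_integrableM => //; apply: circle_continuousM;
    exact: circle_continuousX.
transitivity (circle_int (fun zeta =>
   \sum_(k < n) c k 0 * (W zeta * (a zeta ^+ i * b zeta ^+ k)) +
   W zeta * (a zeta ^+ i * b zeta ^+ n))).
  congr circle_int; apply/funext => zeta.
  rewrite hornerD hornerXn /q horner_sum addrC.
  under [X in _ * (_ * (X + _)) = _]eq_bigr do rewrite hornerZ hornerXn.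
  rewrite !mulrDr !mulr_sumr; congr (_ + _); apply: eq_bigr => k _; ring.
rewrite circle_intD//; last first.
  rewrite (_ : (fun _ => _) = fun zeta => W zeta * (a zeta ^+ i * q.[b zeta])).
    apply: circle_integrableM => //; apply: circle_continuousM.
      exact: circle_continuousX.
    exact: circle_continuous_horner.
  apply/funext => zeta; rewrite /q horner_sum !mulr_sumr.
  by apply: eq_bigr => k _; rewrite hornerZ hornerXn; ring.
rewrite circle_int_sum//; congr (_ + _).
by apply: eq_bigr => k _; rewrite [M i k]mxE mulrC.
Qed.

(* [F] is the integrand of the orthogonality relations; it is only required to
   agree with the moments of [a] and [b] on the circle, since integer powers of
   [zeta] do not combine at [zeta = 0]. *)
Lemma circle_int_kernel (n : nat) (W a b kappa : C -> C) (x c e : C)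
    (F : {poly C} -> nat -> C -> C) :
  circle_integrable W -> circle_continuous a -> circle_continuous b ->
  (forall t, a (circle_point t) != x) ->
  (forall t, kappa (circle_point t) = c / (x - a (circle_point t)) - e) ->
  (forall p m t, F p m (circle_point t) = W (circle_point t) *
     (a (circle_point t) ^+ m * p.[b (circle_point t)])) ->
  \det (\matrix_(i < n, k < n)
    circle_int (fun zeta => W zeta * (a zeta ^+ i * b zeta ^+ k))) != 0 ->
  let p := xget 0 [set p | monic_deg n p /\
    forall m, (m < n)%N -> circle_int (F p m) = 0]%classic in
  circle_int (fun zeta => W zeta * kappa zeta * p.[b zeta]) =
  c / \det (\matrix_(i < n, k < n)
         circle_int (fun zeta => W zeta * (a zeta ^+ i * b zeta ^+ k))) *
    ((n.+1)`!%:R^-1 * circle_iterint (fun v : n.+1.-tuple C =>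
      (\prod_(j < n.+1) (W (tnth v j) / (x - a (tnth v j)))) *
      \prod_(j < n.+1) \prod_(k < n.+1 | (j < k)%N)
        ((b (tnth v k) - b (tnth v j)) * (a (tnth v k) - a (tnth v j)))))
  - e * (circle_int W * (n == 0)%:R).
Proof.
move=> Wi ac bc xa kE FE detM p.
have [pmd orth] : monic_deg n p /\ forall m, (m < n)%N ->
    circle_int (fun zeta => W zeta * (a zeta ^+ m * p.[b zeta])) = 0.
  (* The witness [q] shows that the set is inhabited, so [xget] returns one of its members and not
     the default 0. *)
  have [q [qm qo]] := exists_monic_orthogonal _ _ _ _ Wi ac bc detM.
  have := @xgetPex _ 0 [set p | monic_deg n p /\
    forall m, (m < n)%N -> circle_int (F p m) = 0]%classic.
  rewrite -/p => -[|pm po]; last first.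
    split=> // m mn; rewrite -[RHS](po m mn); apply: eq_circle_int => t.
    by rewrite FE.
  exists q; split=> // m mn; rewrite -[RHS](qo m mn).
  by apply: eq_circle_int => t; rewrite FE.
have xa0 t : x - a (circle_point t) != 0 by rewrite subr_eq0 eq_sym.
have fi := circle_integrable_resolvent W a x Wi ac xa.
rewrite (andreief _ _ _ _ fi ac bc) (det_circle_int_kernel _ _ _ _ _ _ Wi ac bc xa pmd orth).
rewrite mulKf ?pnatr_eq0 -?lt0n ?fact_gt0// [_ * \det _]mulrC [c / _ * _]mulrA divfK//.
have pb := circle_continuous_horner p _ bc.
(* For n > 0 this is the orthogonality relation with m = 0; for n = 0 the monic polynomial [p] is
   1. *)
have <- : circle_int (fun zeta => W zeta * p.[b zeta]) =
    circle_int W * (n == 0)%:R.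
  case: n @p {detM FE} pmd orth {pb} => [|n] p [pm ps] orth; last first.
    rewrite mulr0 -[RHS](orth 0)//; congr circle_int; apply/funext => zeta.
    by rewrite expr0 mul1r.
  rewrite mulr1; congr circle_int; apply/funext => zeta.
  have /size_poly1P[k _ pk] : size p == 1 by rewrite ps.
  move: pm; rewrite pk => /monicP; rewrite lead_coefC => ->.
  by rewrite hornerC mulr1.
rewrite -circle_intZ; last exact: circle_integrableM.
rewrite -mulNr -circle_intZ; last exact: circle_integrableM.
rewrite -circle_intD; last 2 first.
- by apply: circle_integrableZ; exact: circle_integrableM.
- by apply: circle_integrableZ; exact: circle_integrableM.
apply: eq_circle_int => t; rewrite kE; field; exact: xa0.
Qed.

End Andreief.

(** * Partial fractions of the kernels and integer powers on the circle *)

Lemma cayley_kernel (K : fieldType) (u z : K) : u != z ->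
  (u + z) / (u - z) = - (2 * z) / (z - u) + 1.
Proof.
by move=> uz; field; rewrite !subr_eq0 uz eq_sym uz.
Qed.

(** The expansion in inverse variables, for P and R; its constant has the opposite sign to that in
    [cayley_kernel], which serves Q and S. *)
Lemma cayley_kernelV (K : fieldType) (u z : K) : u != 0 -> z != 0 -> u != z ->
  (u + z) / (u - z) = 2 * z^-1 / (z^-1 - u^-1) - 1.
Proof.
by move=> u0 z0 uz; field; rewrite u0 z0 mulN1r subr_eq0.
Qed.

Section CirclePowers.
Context {R : realType}.
Local Notation C := R[i].

Lemma norm_circle_point (t : R) : `|circle_point t : C| = 1.
Proof. by rewrite normc_def /= cos2Dsin2 sqrtr1. Qed.

Lemma circle_point_neq0 (t : R) : (circle_point t : C) != 0.
Proof. by rewrite -normr_eq0 norm_circle_point oner_eq0. Qed.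

(** The moduli differ; negative exponents reduce to positive ones by injectivity of inversion. *)
Lemma circle_pointXz_neq (t : R) (z : C) (m : int) : m != 0 -> `|z| != 1 ->
  circle_point t ^ m != z ^ m.
Proof.
move=> m0 z1.
have XN k : circle_point t ^+ k.+1 != z ^+ k.+1.
  apply: contra z1 => /eqP /(congr1 Num.norm).
  by rewrite !normrX norm_circle_point expr1n => /esym/eqP; rewrite pexprn_eq1.
case: m m0 => [[|k]//|k] _; first exact: XN.
by apply: contra (XN k) => /eqP /invr_inj ->.
Qed.

Lemma circle_continuousXz (m : int) : circle_continuous (fun zeta : C => zeta ^ m).
Proof.
case: m => k; first by apply: circle_continuousX; exact: circle_continuous_id.
apply: circle_continuousV => [|t].
  by apply: circle_continuousX; exact: circle_continuous_id.
by rewrite expf_neq0// circle_point_neq0.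
Qed.

(** Common form of the four identities, with a = zeta^alpha and b = zeta^beta: (alpha, beta) is (-2,
    1), (1, -2), (-1, 2), (2, -1) for P, Q, R, S. The parameters [kappa], [F], [Delta] and [D] are
    tied down by equations, so that each definition can be matched in its own notation. *)
Lemma circle_int_power_kernel (w : C -> C) (n : nat) (alpha beta r : int)
    (z c e : C) (kappa : C -> C) (F : {poly C} -> nat -> C -> C)
    (Delta : C -> C -> C) (D : C) :
  circle_integrable w -> alpha != 0 -> `|z| != 1 ->
  (forall t, kappa (circle_point t) =
     c / (z ^ alpha - circle_point t ^ alpha) - e) ->
  (forall p m t, F p m (circle_point t) = p.[circle_point t ^ beta] *
     circle_point t ^ (alpha * m%:Z - r) * w (circle_point t)) ->
  (forall u v, Delta u v =
     (v ^ beta - u ^ beta) * (v ^ alpha - u ^ alpha)) ->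
  D = \det (\matrix_(i < n, k < n)
    fourier_coef w (r - alpha * (i : nat)%:Z - beta * (k : nat)%:Z)) ->
  D != 0 ->
  let p := xget 0 [set p | monic_deg n p /\
    forall m, (m < n)%N -> circle_int (F p m) = 0]%classic in
  circle_int (fun zeta => w zeta * zeta ^ (- r) * kappa zeta *
                          p.[zeta ^ beta]) =
  c / D *
    ((n.+1)`!%:R^-1 * circle_iterint (fun v : n.+1.-tuple C =>
      (\prod_(j < n.+1) (w (tnth v j) * tnth v j ^ (- r) /
                         (z ^ alpha - tnth v j ^ alpha))) *
      \prod_(j < n.+1) \prod_(k < n.+1 | (j < k)%N)
        Delta (tnth v j) (tnth v k)))
  - e * (fourier_coef w r * (n == 0)%:R).
Proof.
move=> wi alpha0 z1 kE FE DeltaE DE D0.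
have -> : Delta = fun u v =>
    (v ^ beta - u ^ beta) * (v ^ alpha - u ^ alpha).
  by apply/funext => u; apply/funext => v.
have XzE m1 m2 t : circle_point t ^ (m1 + m2) =
    circle_point t ^ m1 * circle_point t ^ m2 :> C.
  by rewrite expfzDr// circle_point_neq0.
pose W zeta : C := w zeta * zeta ^ (- r).
have Wi : circle_integrable W.
  by apply: circle_integrableM => //; exact: circle_continuousXz.
(* Since w_k integrates zeta^(-k) w, the moment of a^i b^k against [W] is the Fourier coefficient of
   index r - alpha i - beta k. *)
have {}DE : D = \det (\matrix_(i < n, k < n) circle_int (fun zeta =>
    W zeta * ((zeta ^ alpha) ^+ i * (zeta ^ beta) ^+ k))).
  rewrite DE; congr (\det _); apply/matrixP => i k; rewrite !mxE.
  apply: eq_circle_int => t.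
  rewrite !exprnP !exprz_exp /W !opprB !XzE; ring.
have fourierE : fourier_coef w r = circle_int W.
  by congr circle_int; apply/funext => zeta; rewrite mulrC.
rewrite fourierE DE; apply: circle_int_kernel => //.
- exact: circle_continuousXz.
- exact: circle_continuousXz.
- by move=> t; exact: circle_pointXz_neq.
- by move=> p m t; rewrite FE exprnP exprz_exp XzE /W; ring.
- by rewrite -DE.
Qed.

End CirclePowers.

(** * Choice of exponents for P, Q, R and S *)

Theorem theorem6p2 (R : realType) (w : R[i] -> R[i])
    (w_int : circle_integrable w) (n : nat) (r s : int) (z : R[i])
    (z_neq0 : z != 0) (z_norm : `|z| != 1) :
  (detD w n r != 0 ->
     hatP w n r z =
       2 * z ^- 2 / detD w n r *
         calD n.+1 (fun zeta =>
           w zeta * zeta ^ (- r) / (z ^- 2 - zeta ^- 2))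
       - fourier_coef w r * (n == 0%N)%:R
     /\
     hatQ w n r z =
       - (2 * z / detD w n r) *
         calD n.+1 (fun zeta => w zeta * zeta ^ (- r) / (z - zeta))
       + fourier_coef w r * (n == 0%N)%:R)
  /\
  (detE w n s != 0 ->
     hatR w n s z =
       2 * z^-1 / detE w n s *
         calE n.+1 (fun zeta =>
           w zeta * zeta ^ (- s) / (z^-1 - zeta^-1))
       - fourier_coef w s * (n == 0%N)%:R
     /\
     hatS w n s z =
       - (2 * z ^+ 2 / detE w n s) *
         calE n.+1 (fun zeta =>
           w zeta * zeta ^ (- s) / (z ^+ 2 - zeta ^+ 2))
       + fourier_coef w s * (n == 0%N)%:R).
Proof.
have N1 : forall t, circle_point t != 0 :> R[i] := circle_point_neq0.
have Nz k t : circle_point t ^+ k.+1 != z ^+ k.+1.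
  exact: (circle_pointXz_neq t z k.+1).
split=> [D0|E0]; split.
- rewrite -[X in _ - X]mul1r.
  apply: (circle_int_power_kernel w n (- 2) 1 r z (2 * z ^- 2) 1 _ _
    (fun u v => (v - u) * (v ^- 2 - u ^- 2))) => //.
  + by move=> t; apply: cayley_kernelV; rewrite ?expf_neq0.
  + by move=> p m t; rewrite mulNr.
  + congr (\det _); apply/matrixP => i k; rewrite !mxE; congr fourier_coef.
    by rewrite mulNr opprK mul1r.
(* The signs are moved to fit c = -2z and e = -1, as read off from [cayley_kernel]. *)
- rewrite -[- (_ / _)]mulNr -[X in _ + X]opprK -[X in _ - X]mulN1r.
  apply: (circle_int_power_kernel w n 1 (- 2) r z (- (2 * z)) (- 1) _ _
    (fun u v => (v - u) * (v ^- 2 - u ^- 2))) => //.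
  + by move=> t; rewrite opprK; apply: cayley_kernel; exact: (Nz 0 t).
  + by move=> p m t; rewrite mul1r.
  + by move=> u v; rewrite mulrC.
  (* The rows of [detD] carry the powers of zeta^-2, which is here the column variable b; hence the
     transpose. *)
  + rewrite -det_tr; congr (\det _); apply/matrixP => i k; rewrite !mxE.
    by congr fourier_coef; rewrite mulNr opprK mul1r addrAC.
- rewrite -[X in _ - X]mul1r.
  apply: (circle_int_power_kernel w n (- 1) 2 s z (2 * z^-1) 1 _ _
    (fun u v => (v ^+ 2 - u ^+ 2) * (v^-1 - u^-1))) => //.
  + by move=> t; apply: cayley_kernelV => //; exact: (Nz 0 t).
  + by move=> p m t; rewrite mulN1r.
  + congr (\det _); apply/matrixP => i k; rewrite !mxE; congr fourier_coef.
    by rewrite mulN1r opprK.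
- rewrite -[- (_ / _)]mulNr -[X in _ + X]opprK -[X in _ - X]mulN1r.
  apply: (circle_int_power_kernel w n 2 (- 1) s z (- (2 * z ^+ 2)) (- 1) _ _
    (fun u v => (v ^+ 2 - u ^+ 2) * (v^-1 - u^-1))) => //.
  + by move=> t; rewrite opprK; apply: cayley_kernel.
  + by move=> u v; rewrite mulrC.
  (* Likewise the rows of [detE] carry the powers of zeta^-1, here the column variable. *)
  + rewrite -det_tr; congr (\det _); apply/matrixP => i k; rewrite !mxE.
    by congr fourier_coef; rewrite mulN1r opprK addrAC.
Qed.
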